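(* For all integers $n\ge 1$ we have $$\int_0^\pi \left(1+\frac{\sqrt5}{3}\cos x\right)^{n-1}\ln\left(1+\frac{\sqrt5}{3}\cos x\right)\sin x\,dx = \frac{6}{n\sqrt5}\left(\frac23\right)^n L_{2n}\ln\alpha + \left(-\frac1n+\ln\left(\frac23\right)\right)\left(\frac23\right)^n\frac{3}{n}F_{2n}.$$
   Context: $\alpha=(1+\sqrt5)/2$. The Fibonacci numbers are $F_0=0$, $F_1=1$, $F_n=F_{n-1}+F_{n-2}$, and the Lucas numbers are $L_0=2$, $L_1=1$, $L_n=L_{n-1}+L_{n-2}$. *)

(* Defs.v *)
From Stdlib Require Import Reals.
From Coquelicot Require Import Coquelicot.
Open Scope R_scope.

Fixpoint fib (n : nat) : nat :=
  match n with
  | O => 0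
  | S m => match m with
           | O => 1
           | S k => fib m + fib k
           end
  end.

Fixpoint lucas (n : nat) : nat :=
  match n with
  | O => 2
  | S m => match m with
           | O => 1
           | S k => lucas m + lucas k
           end
  end.

Definition alpha : R := (1 + sqrt 5) / 2.

(* Main.v *)
(** With [u = 1 + sqrt 5 / 3 * cos x] the integrand is, up to a constant, the
    derivative of [u ^ n * (1 / n - ln u)].  The values of [u] at the endpoints
    are [2 / 3 * alpha ^ 2] and [2 / 3 * beta ^ 2], where [beta = - / alpha] is
    the conjugate of [alpha], so Binet's formulas give the claim. *)
Require Import Defs.
From Stdlib Require Import Reals Lra Lia.
From Coquelicot Require Import Coquelicot.
Open Scope R_scope.

Definition beta : R := (1 - sqrt 5) / 2.

Lemma sqrt5_sqr : sqrt 5 * sqrt 5 = 5.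
Proof. apply sqrt_sqrt; lra. Qed.

Lemma sqrt5_bounds : 2 < sqrt 5 < 3.
Proof. pose proof sqrt5_sqr; pose proof (sqrt_pos 5); split; nra. Qed.

Lemma alpha_sqr : alpha ^ 2 = alpha + 1.
Proof. unfold alpha; pose proof sqrt5_sqr; nra. Qed.

Lemma beta_sqr : beta ^ 2 = beta + 1.
Proof. unfold beta; pose proof sqrt5_sqr; nra. Qed.

Lemma alpha_pos : 0 < alpha.
Proof. unfold alpha; pose proof sqrt5_bounds; lra. Qed.

(** Since [alpha * beta = -1], the squares are mutually inverse. The square is kept because [beta]
    is negative. *)
Lemma ln_sqr_beta : ln (beta ^ 2) = - (2 * ln alpha).
Proof.
  pose proof alpha_pos.
  replace (beta ^ 2) with (/ alpha ^ 2).
  - rewrite ln_Rinv, ln_pow by (try apply pow_lt; assumption); simpl; ring.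
  - apply Rmult_eq_reg_l with (alpha ^ 2); [| apply pow_nonzero; lra].
    rewrite Rinv_r by (apply pow_nonzero; lra).
    rewrite alpha_sqr, beta_sqr; unfold alpha, beta.
    pose proof sqrt5_sqr; lra.
Qed.

Lemma two_step_power (r : R) (n : nat) :
  r ^ 2 = r + 1 -> r ^ S (S n) = r ^ S n + r ^ n.
Proof.
  intros Hr; replace (r ^ S (S n)) with (r ^ 2 * r ^ n) by (simpl; ring).
  rewrite Hr; simpl; ring.
Qed.

Lemma fib_SS (n : nat) : fib (S (S n)) = (fib (S n) + fib n)%nat.
Proof. reflexivity. Qed.

Lemma lucas_SS (n : nat) : lucas (S (S n)) = (lucas (S n) + lucas n)%nat.
Proof. reflexivity. Qed.

(** Both sides obey the same second-order recurrence, so the induction carries two consecutive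
    indices. *)
Lemma binet_fib (n : nat) : sqrt 5 * INR (fib n) = alpha ^ n - beta ^ n.
Proof.
  enough (sqrt 5 * INR (fib n) = alpha ^ n - beta ^ n /\
          sqrt 5 * INR (fib (S n)) = alpha ^ S n - beta ^ S n) by tauto.
  induction n as [|n [IH0 IH1]].
  - unfold alpha, beta; simpl; split; field.
  - split; [exact IH1 |].
    rewrite fib_SS, plus_INR, Rmult_plus_distr_l, IH0, IH1.
    rewrite (two_step_power _ _ alpha_sqr), (two_step_power _ _ beta_sqr); ring.
Qed.

Lemma binet_lucas (n : nat) : INR (lucas n) = alpha ^ n + beta ^ n.
Proof.
  enough (INR (lucas n) = alpha ^ n + beta ^ n /\
          INR (lucas (S n)) = alpha ^ S n + beta ^ S n) by tauto.
  induction n as [|n [IH0 IH1]].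
  - unfold alpha, beta; simpl; split; field.
  - split; [exact IH1 |].
    rewrite lucas_SS, plus_INR, IH0, IH1.
    rewrite (two_step_power _ _ alpha_sqr), (two_step_power _ _ beta_sqr); ring.
Qed.

Lemma base_pos (x : R) : 0 < 1 + sqrt 5 / 3 * cos x.
Proof. pose proof sqrt5_bounds; pose proof (COS_bound x); nra. Qed.

(** The factor [3 / (INR n * sqrt 5)] compensates the [- n] from differentiating
    [u ^ n * (1 / n - ln u)] in [u] and the [- sqrt 5 / 3] in [u' = - sqrt 5 / 3 * sin x]; the two
    signs cancel. *)
Definition primitive (n : nat) (x : R) : R :=
  let u := 1 + sqrt 5 / 3 * cos x in
  3 / (INR n * sqrt 5) * u ^ n * (1 / INR n - ln u).

Lemma is_derive_primitive (n : nat) (x : R) : (1 <= n)%nat ->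
  is_derive (primitive n) x
    ((1 + sqrt 5 / 3 * cos x) ^ (n - 1) * ln (1 + sqrt 5 / 3 * cos x) * sin x).
Proof.
  intros hn; pose proof (base_pos x) as Hu; pose proof sqrt5_bounds.
  destruct n as [|m]; [lia |].
  pose proof (lt_0_INR (S m) ltac:(lia)).
  unfold primitive; set (c := INR (S m)) in *.
  auto_derive; [exact Hu |].
  replace (S m - 1)%nat with m by lia; cbn [Init.Nat.pred pow].
  (* Folds the unfolded [INR (S m)] back into [c], so that [field] sees a single nonzero
     constant. *)
  change (match m with O => 1 | S _ => INR m + 1 end) with c.
  field; lra.
Qed.

Theorem theorem3 (n : nat) (hn : (1 <= n)%nat) :
  is_RInt
    (fun x : R =>
       (1 + sqrt 5 / 3 * cos x) ^ (n - 1) * ln (1 + sqrt 5 / 3 * cos x) * sin x)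
    0 PI
    (6 / (INR n * sqrt 5) * (2 / 3) ^ n * INR (lucas (2 * n)) * ln alpha
     + (- (1 / INR n) + ln (2 / 3)) * (2 / 3) ^ n * (3 / INR n) * INR (fib (2 * n))).
Proof.
  pose proof sqrt5_bounds; pose proof alpha_pos.
  pose proof (lt_0_INR n ltac:(lia)).
  match goal with |- is_RInt _ _ _ ?v =>
    replace v with (minus (primitive n PI) (primitive n 0)) end.
  - apply (is_RInt_derive (primitive n)).
    + intros x _; apply is_derive_primitive, hn.
    (* The integrand is continuous because it is differentiable, [ln] being applied to a positive
       base. *)
    + intros x _; apply (ex_derive_continuous (V := R_NormedModule)).
      auto_derive; repeat split; apply base_pos.
  - assert (Hb : 0 < beta ^ 2) by (rewrite beta_sqr; unfold beta; lra).
    assert (Ha : 0 < alpha ^ 2) by (apply pow_lt; assumption).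
    unfold primitive, minus, plus, opp; simpl; rewrite cos_0, cos_PI.
    replace (1 + sqrt 5 / 3 * 1) with (2 / 3 * alpha ^ 2)
      by (rewrite alpha_sqr; unfold alpha; field).
    replace (1 + sqrt 5 / 3 * -1) with (2 / 3 * beta ^ 2)
      by (rewrite beta_sqr; unfold beta; field).
    (* The endpoint logarithms become [ln (2 / 3) + 2 * ln alpha] at 0 and
       [ln (2 / 3) - 2 * ln alpha] at [PI]. In the difference of endpoint values, the common part
       [1 / n - ln (2 / 3)] therefore multiplies [alpha ^ (2 * n) - beta ^ (2 * n)], up to sign,
       giving the Fibonacci term, while [2 * ln alpha] multiplies the sum of these powers, giving
       the Lucas term. *)
    rewrite !ln_mult, ln_sqr_beta, ln_pow, !Rpow_mult_distr, <- !pow_mult by lra.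
    change (n + (n + 0))%nat with (2 * n)%nat.
    rewrite binet_lucas.
    replace (INR (fib (2 * n))) with ((alpha ^ (2 * n) - beta ^ (2 * n)) / sqrt 5)
      by (rewrite <- binet_fib; field; lra).
    replace (INR 2) with 2 by (simpl; ring).
    field; lra.
Qed.
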